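(* Let $r\ge 1$, let $\mathbf{a}=(a_1,\dots,a_r)$ be a vector of positive integers, let $D=\mathrm{lcm}(a_1,\dots,a_r)$, and let $$\mathbf{J}=\Big\{\mathbf{j}=(j_1,\dots,j_r)\in\mathbb{Z}^r:\ 0\le j_i\le \tfrac{D}{a_i}-1 \text{ for } i=1,\dots,r\Big\}.$$ Then for every integer $n\ge 0$, $$p_{\mathbf{a}}(n)=\sum_{\substack{\mathbf{j}\in\mathbf{J}\\ a_1j_1+\cdots+a_rj_r\equiv n \ (\mathrm{mod}\ D)}}\binom{\frac{n-a_1j_1-\cdots-a_rj_r}{D}+r-1}{r-1}.$$
   Context: For a vector $\mathbf{a}=(a_1,\dots,a_r)$ of positive integers and an integer $n\ge 0$, the restricted partition function is $$p_{\mathbf{a}}(n)=\#\Big\{(x_1,\dots,x_r)\in\mathbb{Z}_{\ge 0}^r:\ \sum_{i=1}^r a_ix_i=n\Big\}.$$ The binomial coefficient is $\binom{x}{r-1}=\frac{x(x-1)\cdots(x-r+2)}{(r-1)!}$, equal to $1$ when $r=1$. *)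

(* Defs.v *)
From HB Require Import structures.
From mathcomp Require Import all_boot all_order all_algebra.
From mathcomp Require Import finmap.
From mathcomp Require Import boolp classical_sets functions cardinality fsbigop.

Set Implicit Arguments.
Unset Strict Implicit.
Unset Printing Implicit Defensive.

Import Order.TTheory GRing.Theory Num.Theory.

Local Open Scope classical_set_scope.
Local Open Scope ring_scope.

Definition partition_solutions (r : nat) (a : 'I_r -> nat) (n : nat) :
    set {ffun 'I_r -> nat} :=
  [set x | (\sum_(i < r) a i * x i = n)%N].

(* fset_set returns the empty set on infinite sets; this case never occurs
   for positive a, by finite_partition_solutions below. *)
Definition restricted_partition (r : nat) (a : 'I_r -> nat) (n : nat) : nat :=
  #|` fset_set (partition_solutions a n)|.

Definition lcm_vec (r : nat) (a : 'I_r -> nat) : nat :=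
  \big[lcmn/1%N]_(i < r) a i.

Definition weight (r : nat) (a : 'I_r -> nat) (j : {ffun 'I_r -> int}) : int :=
  \sum_(i < r) (a i)%:Z * j i.

(* The quotient lcm_vec a %/ a i is exact, see dvdn_lcm_vec. *)
Definition index_box (r : nat) (a : 'I_r -> nat) : set {ffun 'I_r -> int} :=
  [set j | forall i : 'I_r, 0 <= j i <= (lcm_vec a %/ a i)%N%:Z - 1].

(* The binomial coefficient as a polynomial of degree k in its upper argument:
   x (x - 1) ... (x - k + 1) / k! *)
Definition gbinom (x : rat) (k : nat) : rat :=
  (\prod_(i < k) (x - i%:R)) / k`!%:R.

Lemma dvdn_lcm_vec (r : nat) (a : 'I_r -> nat) (i : 'I_r) :
  (a i %| lcm_vec a)%N.
Proof. by rewrite /lcm_vec (bigD1 i) //= dvdn_lcml. Qed.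

Lemma finite_partition_solutions (r : nat) (a : 'I_r -> nat) (n : nat) :
  (forall i, (0 < a i)%N) -> finite_set (partition_solutions a n).
Proof.
move=> a_gt0.
pose h (y : {ffun 'I_r -> 'I_n.+1}) : {ffun 'I_r -> nat} :=
  [ffun i => y i : nat].
apply: (@sub_finite_set _ _ (h @` setT)); last exact/finite_image/finite_finset.
move=> x /= xn; exists [ffun i => inord (x i)] => //.
apply/ffunP => i; rewrite !ffunE inordK // ltnS -xn (bigD1 i) //=.
by rewrite (leq_trans (leq_pmull (x i) (a_gt0 i))) ?leq_addr.
Qed.

Lemma finite_index_box (r : nat) (a : 'I_r -> nat) : finite_set (index_box a).
Proof.
pose h (y : {ffun 'I_r -> 'I_(lcm_vec a).+1}) : {ffun 'I_r -> int} :=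
  [ffun i => (y i : nat)%:Z].
apply: (@sub_finite_set _ _ (h @` setT)); last exact/finite_image/finite_finset.
move=> j /= jbox; exists [ffun i => inord `|j i|%N] => //.
apply/ffunP => i; have /andP[j_ge0 jle] := jbox i.
rewrite !ffunE inordK ?gez0_abs // ltnS -lez_nat gez0_abs //.
apply: (le_trans jle); apply: (@le_trans _ _ (lcm_vec a %/ a i)%N%:Z).
  by rewrite gerBl.
by rewrite lez_nat leq_div.
Qed.

(* Main.v *)
Require Import Defs.
From mathcomp Require Import all_boot all_order all_algebra.
From mathcomp Require Import finmap.
From mathcomp Require Import boolp classical_sets functions cardinality fsbigop.
From mathcomp Require Import zify.

(** Write [D = lcm_vec a] and [c i = D %/ a i].  Euclidean division of each
    coordinate, [x i = q i * c i + k i] with [k i < c i], turns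
    [\sum_i a i * x i] into [D * \sum_i q i + \sum_i a i * k i], because
    [a i * c i = D] does not depend on [i].  Grouping the solutions [x] by
    their residue vector [k] ([restricted_partition_fibers]) thus reduces the
    count to the case where all parts are equal to 1: if [n] is [D * m] plus
    the weight of [k], the solutions above [k] are the compositions of [m] into
    [r] nonnegative terms ([card_residue_fiber]), and there are
    ['C(m + r - 1, r - 1)] of them ([restricted_partition_ones]).

    A residue vector whose weight is congruent to [n] but exceeds it has no
    solution above it.  The corresponding term of the formula vanishes too: the
    weight of a vector of the box is less than [r * D], so that the upper
    argument of the binomial is still a natural number, smaller than [r - 1]
    ([gbinom_residue_fiber]). *)

Import Order.TTheory GRing.Theory Num.Theory.

Local Open Scope classical_set_scope.
Local Open Scope ring_scope.

(** For [m < k] both sides are zero, one of the factors being [m - m]. *)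
Lemma gbinom_nat (m k : nat) : gbinom m%:R k = 'C(m, k)%:R.
Proof.
have k_neq0 : k`!%:R != 0 :> rat by rewrite pnatr_eq0 -lt0n fact_gt0.
apply: (mulIf k_neq0); rewrite /gbinom divfK // -natrM bin_ffact.
have [lt_mk|le_km] := ltnP m k.
  by rewrite ffact_small // (bigD1 (Ordinal lt_mk)) //= subrr mul0r.
rewrite ffact_prod natr_prod; apply: eq_bigr => i _.
by rewrite natrB // (leq_trans (ltnW (ltn_ord i))).
Qed.

(** Solutions with unit parts are tuples with a prescribed sum; no entry can
    exceed that sum, so the tuples over ['I_m.+1] give them all. *)
Lemma restricted_partition_ones (r m : nat) :
  restricted_partition (fun _ : 'I_r.+1 => 1%N) m = 'C(m + r, r).
Proof.
pose A := [set t : r.+1.-tuple 'I_m.+1 | (\sum_(i <- t) i == m)%N]%SET.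
pose h (t : r.+1.-tuple 'I_m.+1) := [ffun i => tnth t i : nat].
rewrite addnC -card_ord_partitions /restricted_partition -/A.
have h_inj : injective h.
  move=> s t /ffunP eq_st; apply: eq_from_tnth => i; apply: val_inj.
  by have := eq_st i; rewrite !ffunE.
suff -> : fset_set (partition_solutions (fun _ : 'I_r.+1 => 1%N) m) =
          [fset h t | t in A]%fset by rewrite card_imfset // cardE.
apply/fsetP => x; rewrite in_fset_set; last exact: finite_partition_solutions.
apply/idP/imfsetP => [|[t /=]].
  rewrite inE /partition_solutions /=.
  under eq_bigr do rewrite mul1n.
  move=> sum_x.
  have lt_x i : (x i < m.+1)%N by rewrite ltnS -sum_x (bigD1 i) //= leq_addr.
  exists [tuple inord (x i) | i < r.+1].
    rewrite inE big_tuple; apply/eqP; rewrite -[RHS]sum_x.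
    by apply: eq_bigr => i _; rewrite tnth_mktuple inordK.
  by apply/ffunP => i; rewrite ffunE tnth_mktuple inordK.
rewrite [t \in A]inE big_tuple => /eqP sum_t ->.
rewrite inE /partition_solutions /=.
by rewrite -[RHS]sum_t; apply: eq_bigr => i _; rewrite mul1n ffunE.
Qed.

(** The values are integers so that they can be compared with the elements of
    [index_box a]. *)
Definition residues {r : nat} (a : 'I_r -> nat) (x : {ffun 'I_r -> nat}) :
    {ffun 'I_r -> int} :=
  [ffun i => (x i %% (lcm_vec a %/ a i))%N%:Z].

Definition residue_fiber {r : nat} (a : 'I_r -> nat) (n : nat)
    (j : {ffun 'I_r -> int}) : {fset {ffun 'I_r -> nat}} :=
  fset_set (partition_solutions a n `&` [set x | residues a x = j]).

Section PositiveParts.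

Context {r : nat} (a : 'I_r -> nat) (ha : forall i, (0 < a i)%N).

Lemma lcm_vec_gt0 : (0 < lcm_vec a)%N.
Proof. by elim/big_ind: (lcm_vec a) => // m n; rewrite lcmn_gt0 => -> ->. Qed.

Lemma cofactor_gt0 (i : 'I_r) : (0 < lcm_vec a %/ a i)%N.
Proof. by rewrite divn_gt0 // dvdn_leq ?lcm_vec_gt0 ?dvdn_lcm_vec. Qed.

Lemma mul_cofactor (i : 'I_r) : (a i * (lcm_vec a %/ a i) = lcm_vec a)%N.
Proof. by rewrite mulnC divnK ?dvdn_lcm_vec. Qed.

Lemma weight_nat (k : 'I_r -> nat) :
  weight a [ffun i => (k i)%:Z] = (\sum_(i < r) a i * k i)%N%:Z.
Proof.
rewrite /weight -[RHS]natz natr_sum.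
by apply: eq_bigr => i _; rewrite ffunE natz.
Qed.

(** Euclidean division of every [x i] by [lcm_vec a %/ a i]; the quotients all
    get the same coefficient [lcm_vec a]. *)
Lemma weight_residues (x : {ffun 'I_r -> nat}) :
  (\sum_(i < r) a i * x i)%N%:Z =
  (lcm_vec a * \sum_(i < r) x i %/ (lcm_vec a %/ a i))%N%:Z +
    weight a (residues a x).
Proof.
rewrite weight_nat -PoszD; congr Posz.
rewrite big_distrr -big_split; apply: eq_bigr => i _ /=.
rewrite {1}(divn_eq (x i) (lcm_vec a %/ a i)) mulnDr mulnCA mul_cofactor.
by rewrite mulnC.
Qed.

(** With the residues fixed, a solution is determined by its vector of
    quotients, which can be any vector of sum [m]. *)
Lemma card_residue_fiber (k : 'I_r -> nat) (m n : nat) :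
    (forall i, k i < lcm_vec a %/ a i)%N ->
    n = (lcm_vec a * m + \sum_(i < r) a i * k i)%N ->
  #|` residue_fiber a n [ffun i => (k i)%:Z]| =
  restricted_partition (fun _ : 'I_r => 1%N) m.
Proof.
move=> lt_k def_n.
pose glue (q : {ffun 'I_r -> nat}) : {ffun 'I_r -> nat} :=
  [ffun i => (q i * (lcm_vec a %/ a i) + k i)%N].
have glue_inj : injective glue.
  move=> p q /ffunP eq_pq; apply/ffunP => i; have /eqP := eq_pq i.
  by rewrite !ffunE eqn_add2r eqn_pmul2r ?cofactor_gt0 // => /eqP.
have residues_glue q : residues a (glue q) = [ffun i => (k i)%:Z].
  by apply/ffunP => i; rewrite !ffunE modnMDl modn_small.
have divn_glue q i : (glue q i %/ (lcm_vec a %/ a i) = q i)%N.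
  by rewrite ffunE divnMDl ?cofactor_gt0 // divn_small ?addn0.
rewrite /residue_fiber /restricted_partition.
suff -> : partition_solutions a n `&`
            [set x | residues a x = [ffun i => (k i)%:Z]] =
          glue @` partition_solutions (fun _ : 'I_r => 1%N) m.
  rewrite fset_set_image; last exact: finite_partition_solutions.
  by rewrite card_imfset.
(* The contribution of [k] to both sides cancels, then the factor
   [lcm_vec a]. *)
have sum_eq x : residues a x = [ffun i => (k i)%:Z] ->
    (\sum_(i < r) a i * x i = n)%N <->
    (\sum_(i < r) x i %/ (lcm_vec a %/ a i) = m)%N.
  move=> res_x; have /eqP := weight_residues x.
  rewrite res_x weight_nat -PoszD eqz_nat => /eqP ->; rewrite def_n.
  split=> [/eqP|-> //].
  by rewrite eqn_add2r eqn_pmul2l ?lcm_vec_gt0 // => /eqP.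
apply/seteqP; split=> [x /= [sol_x res_x]|x /= [q sol_q <-]].
  exists [ffun i => x i %/ (lcm_vec a %/ a i)]%N.
    rewrite /partition_solutions /= -(proj1 (sum_eq x res_x) sol_x).
    by apply: eq_bigr => i _; rewrite ffunE mul1n.
  apply/ffunP => i; rewrite !ffunE [RHS](divn_eq _ (lcm_vec a %/ a i)).
  by congr (_ + _)%N; have /ffunP/(_ i) := res_x; rewrite !ffunE => -[].
split; last exact: residues_glue.
apply/(sum_eq _ (residues_glue q)); rewrite -[RHS]sol_q.
by apply: eq_bigr => i _; rewrite divn_glue mul1n.
Qed.

Lemma residue_fiber_eq0 (j : {ffun 'I_r -> int}) (n : nat) :
  n%:Z < weight a j -> residue_fiber a n j = fset0.
Proof.
move=> lt_nj; rewrite /residue_fiber -[RHS]fset_set0; congr fset_set.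
apply/seteqP; split=> // x [/= sol_x res_x].
by have := weight_residues x; rewrite sol_x res_x; lia.
Qed.

Lemma residues_box (x : {ffun 'I_r -> nat}) : index_box a (residues a x).
Proof.
move=> i; rewrite ffunE; have := ltn_pmod (x i) (cofactor_gt0 i); lia.
Qed.

Lemma weight_residues_mod (x : {ffun 'I_r -> nat}) (n : nat) :
    partition_solutions a n x ->
  (weight a (residues a x) = n%:Z %[mod (lcm_vec a)%:Z])%Z.
Proof.
by move=> <-; rewrite weight_residues PoszM mulrC modzMDl.
Qed.

Lemma mem_residue_fiber (n : nat) (j : {ffun 'I_r -> int})
    (x : {ffun 'I_r -> nat}) :
  (x \in residue_fiber a n j) =
  (residues a x == j) && (x \in fset_set (partition_solutions a n)).
Proof.
have finS := finite_partition_solutions n ha.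
rewrite !in_fset_set //; last exact: finite_setIl.
by rewrite in_setI andbC; congr (_ && _); apply/idP/eqP; rewrite inE.
Qed.

(** The residues of a solution lie in the box and have a weight congruent to
    [n], so the fibers over these indices cover all solutions; the fibers over
    indices that are not residues of a solution are empty. *)
Lemma restricted_partition_fibers (n : nat) :
  (restricted_partition a n)%:R =
  \sum_(j \in index_box a `&`
             [set j | (weight a j = n%:Z %[mod (lcm_vec a)%:Z])%Z])
    (#|` residue_fiber a n j|%:R : rat).
Proof.
have finS := finite_partition_solutions n ha.
pose S := fset_set (partition_solutions a n).
rewrite (fsbigE [fset residues a x | x in S]%fset) ?fset_uniq //.
- rewrite /restricted_partition -/S card_fset_sum1.
  rewrite (partition_big_imfset _ (residues a)) natr_sum.
  rewrite big_seq [RHS]big_seq_cond; apply: eq_big => [j|j _].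
    apply/idP/andP => [jS|[] //]; split=> //.
    have /imfsetP[x /= xS ->] := jS; rewrite inE; split.
      exact: residues_box.
    apply: weight_residues_mod; move: xS.
    by rewrite in_fset_set // inE.
  congr _%:R; rewrite -big_filter sum1_size; apply: perm_size.
  apply: uniq_perm; rewrite ?filter_uniq ?fset_uniq // => x.
  by rewrite mem_filter mem_residue_fiber.
- move=> j /= /imfsetP[x /= xS ->]; split; first exact: residues_box.
  by apply: weight_residues_mod; move: xS; rewrite in_fset_set // inE.
- move=> j _ jS; suff -> : residue_fiber a n j = fset0 by [].
  apply/fsetP => x; rewrite mem_residue_fiber in_fset0.
  apply/negP => /andP[/eqP res_x xS]; case/negP: jS; rewrite -res_x.
  exact: in_imfset.
Qed.

End PositiveParts.

(** The sign of [q = (n - weight a j) / lcm_vec a] decides.  If [q >= 0], the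
    fiber is counted by the case of unit parts.  If [q < 0], the fiber is empty,
    and [- r <= q] because the weight is less than [lcm_vec a * r.+1]; hence
    [0 <= q + r < r] and the binomial is zero. *)
Lemma gbinom_residue_fiber (r : nat) (a : 'I_r.+1 -> nat) (n : nat)
    (j : {ffun 'I_r.+1 -> int}) :
    (forall i, 0 < a i)%N -> index_box a j ->
    (weight a j = n%:Z %[mod (lcm_vec a)%:Z])%Z ->
  gbinom ((n%:Z - weight a j)%:~R / (lcm_vec a)%:R + r%:R) r =
  #|` residue_fiber a n j|%:R.
Proof.
move=> ha j_box /eqP; rewrite eq_sym eqz_mod_dvd => /dvdzP[q def_q].
pose k i := `|j i|%N.
have def_j : j = [ffun i => (k i)%:Z].
  by apply/ffunP => i; rewrite ffunE gez0_abs //; case/andP: (j_box i).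
have lt_k i : (k i < lcm_vec a %/ a i)%N.
  by have := j_box i; rewrite /k; lia.
have D_gt0 := lcm_vec_gt0 a ha.
have -> : (n%:Z - weight a j)%:~R / (lcm_vec a)%:R = q%:~R :> rat.
  by rewrite def_q intrM -pmulrn mulfK // pnatr_eq0 -lt0n.
case: q def_q => [m|t] def_q.
  have def_n : n = (lcm_vec a * m + \sum_(i < r.+1) a i * k i)%N.
    by move: def_q; rewrite def_j weight_nat; lia.
  rewrite def_j (card_residue_fiber _ ha _ _ _ lt_k def_n).
  by rewrite restricted_partition_ones -gbinom_nat natrD.
have w_lt : (\sum_(i < r.+1) a i * k i < lcm_vec a * r.+1)%N.
  have : (\sum_(i < r.+1) (a i * k i + 1) <= \sum_(i < r.+1) lcm_vec a)%N.
    by apply: leq_sum => i _; rewrite addn1 -(mul_cofactor a i) ltn_pmul2l.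
  by rewrite big_split /= !sum_nat_const card_ord; lia.
(* Here [q] is [- t.+1]. *)
have lt_tr : (t < r)%N.
  by move: def_q w_lt; rewrite def_j weight_nat; nia.
rewrite residue_fiber_eq0; last by move: def_q; nia.
have -> : (Negz t)%:~R + r%:R = (r - t.+1)%:R :> rat.
  by rewrite NegzE mulrNz natrB // addrC.
by rewrite gbinom_nat bin_small //; lia.
Qed.

Theorem theorem1 (r : nat) (hr : (1 <= r)%N) (a : 'I_r -> nat)
    (ha : forall i : 'I_r, (0 < a i)%N) (n : nat) :
  (restricted_partition a n)%:R =
  \sum_(j \in index_box a `&`
             [set j | (weight a j = n%:Z %[mod (lcm_vec a)%:Z])%Z])
    gbinom ((n%:Z - weight a j)%:~R / (lcm_vec a)%:R + r%:R - 1) (r - 1)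
  :> rat.
Proof.
case: r hr a ha => [//|r] _ a ha.
rewrite restricted_partition_fibers //; apply: eq_fsbigr => j.
rewrite inE => -[j_box j_mod].
by rewrite -gbinom_residue_fiber // subn1 -natr1 -addrA addrK.
Qed.
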